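(* Let $G^*=(T\cup\{v\},E)$ be an unweighted star with $k\ge3$ terminals $T$, in which $v$ is the center of the star. Let $\pi$ be any probability distribution over (edge-weighted) minors of $G^*$ with vertex set $T$, such that every minor $H$ in the support of $\pi$ satisfies $d_H(t,t')\ge d_{G^*}(t,t')$ for all $t,t'\in T$. Then there exist distinct terminals $t',t''\in T$ such that $$\frac{\mathbb{E}_{H\sim\pi}\left[d_H(t',t'')\right]}{d_{G^*}(t',t'')}\ \ge\ 2\left(1-\frac1k\right).$$
   Context: Unweighted means every edge has length $1$; the terminals are the leaves of the star and $v$ is the only non-terminal. A minor is a graph obtained by a sequence of vertex deletions, edge deletions and edge contractions, where no terminal may be deleted and no two terminals may be contracted together (a super-node containing terminal $t$ is identified with $t$); a minor carries its own positive edge length function. $d$ denotes shortest-path distance ($+\infty$ between disconnected vertices). *)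

(* Defs.v *)
From HB Require Import structures.
From mathcomp Require Import all_boot all_order all_algebra.
From mathcomp Require Import all_classical all_reals all_analysis.
From mathcomp Require Import measurable_realfun.

Set Implicit Arguments.
Unset Strict Implicit.
Unset Printing Implicit Defensive.

Import Order.TTheory GRing.Theory Num.Theory.
Local Open Scope classical_set_scope.
Local Open Scope ring_scope.

(* Finite simple graphs whose vertices lie in a fixed ambient finite type [V]:
   deleting and contracting shrinks [vset] and leaves [V] unchanged. *)
Record sgraph (V : finType) := SGraph {
  vset : {set V};
  eset : {set {set V}};
  esetP : forall e, e \in eset -> (#|e| == 2)%N && (e \subset vset)
}.

Section Operations.
Variable V : finType.
Implicit Types (G : sgraph V) (u w : V) (e : {set V}).

Fact del_vertex_proof G u e : e \in [set e in eset G | u \notin e] ->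
  (#|e| == 2)%N && (e \subset vset G :\ u).
Proof.
rewrite inE => /andP[/esetP/andP[-> sub] ue] /=.
by rewrite subsetD1 sub ue.
Qed.

Definition del_vertex G u : sgraph V := SGraph (@del_vertex_proof G u).

Fact del_edge_proof G (e0 : {set V}) e : e \in eset G :\ e0 ->
  (#|e| == 2)%N && (e \subset vset G).
Proof. by rewrite inE => /andP[_ /esetP]. Qed.

Definition del_edge G (e0 : {set V}) : sgraph V :=
  SGraph (@del_edge_proof G e0).

Definition redirect u w (x : V) : V := if x == w then u else x.

Fact contract_proof G u w e :
  e \in [set e in (fun e0 : {set V} => redirect u w @: e0) @: eset G
        | (#|e| == 2)%N] ->
  (#|e| == 2)%N && (e \subset u |: (vset G :\ w)).
Proof.
rewrite inE => /andP[/imsetP[e0 /esetP/andP[_ sub] ->] ->] /=.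
apply/fintype.subsetP => x /imsetP[y /(fintype.subsetP sub) yV ->]; rewrite !inE /redirect.
by case: (eqVneq y w) => [_|yw]; rewrite ?eqxx// yw yV orbT.
Qed.

(* The super-node resulting from the contraction of [[set u; w]] is named [u];
   the loop created by the contracted edge is dropped and parallel edges are
   merged. *)
Definition contract G u w : sgraph V := SGraph (@contract_proof G u w).

(* In [minor_contract], [u] may be a terminal but [w] may not: the super-node
   of a terminal keeps the name of that terminal, and no two terminals are ever
   merged. *)
Inductive minor_step (T : {set V}) (G : sgraph V) : sgraph V -> Prop :=
| minor_del_vertex u of u \in vset G & u \notin T :
    minor_step T G (del_vertex G u)
| minor_del_edge e of e \in eset G :
    minor_step T G (del_edge G e)
| minor_contract u w of [set u; w]%SET \in eset G & w \notin T :
    minor_step T G (contract G u w).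

Inductive minor (T : {set V}) (G : sgraph V) : sgraph V -> Prop :=
| minor_refl : minor T G G
| minor_trans H K of minor T G H & minor_step T H K : minor T G K.

Definition is_star (T : {set V}) (v : V) (G : sgraph V) : Prop :=
  [/\ v \notin T, vset G = (v |: T)%SET
    & eset G = [set [set v; t]%SET | t in T]%SET].

End Operations.

(* The values of [len] outside of [eset] are irrelevant. *)
Record wgraph (V : finType) (R : realType) := WGraph {
  wgraph_sgraph :> sgraph V;
  len : {set V} -> R;
  len_gt0 : forall e, e \in eset wgraph_sgraph -> 0 < len e
}.

Section Distance.
Variables (V : finType) (R : realType).
Implicit Types (G : wgraph V R) (x y : V) (p : seq V).

Definition unweighted G : Prop := forall e, e \in eset G -> len G e = 1.

Definition walk G x y p : bool :=
  path (fun a b => [set a; b]%SET \in eset G) x p && (last x p == y).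

Definition walk_len G x p : R :=
  \sum_(e <- pairmap (fun a b => [set a; b]%SET) x p) len G e.

(* equal to [+oo] when no walk joins [x] to [y] *)
Definition dist G x y : \bar R :=
  ereal_inf [set (walk_len G x p)%:E | p in [set p | walk G x y p]].

End Distance.

Section RandomGraphs.
Variables (V : finType) (R : realType).

Fact empty_wgraph_proof1 (e : {set V}) :
  e \in (finset.set0 : {set {set V}}) ->
  (#|e| == 2)%N && (e \subset (finset.set0 : {set V})).
Proof. by rewrite inE. Qed.

Fact empty_wgraph_proof2 (e : {set V}) :
  e \in eset (SGraph empty_wgraph_proof1) -> 0 < (1 : R).
Proof. by []. Qed.

HB.instance Definition _ := gen_eqMixin (wgraph V R).
HB.instance Definition _ := gen_choiceMixin (wgraph V R).
HB.instance Definition _ := isPointed.Build (wgraph V R)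
  (WGraph empty_wgraph_proof2).

(* The sigma-algebra on weighted graphs is generated by the underlying graph
   and by the lengths of the edges that are present. *)
Definition wgraph_events : set (set (wgraph V R)) :=
  [set A | (exists (W : {set V}) (E : {set {set V}}),
              A = [set H : wgraph V R | vset H = W /\ eset H = E])
        \/ (exists (e : {set V}) (B : set R), measurable B /\
              A = [set H : wgraph V R | e \in eset H /\ B (len H e)])].

Definition measurable_wgraph := g_sigma_algebraType wgraph_events.

Let gen (A : set (wgraph V R)) :
  wgraph_events A -> measurable (A : set measurable_wgraph).
Proof. exact: sub_sigma_algebra. Qed.

Lemma measurable_eset (P : pred {set {set V}}) :
  measurable ([set H | P (eset H)] : set measurable_wgraph).
Proof.
rewrite [X in measurable X](_ : _ = \bigcup_(WE in
    [set WE : {set V} * {set {set V}} | P WE.2])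
    [set H : wgraph V R | vset H = WE.1 /\ eset H = WE.2]).
  apply: fin_bigcup_measurable => [|[W E] _]; first exact: finite_finset.
  by apply: gen; left; exists W, E.
apply/seteqP; split => [H /= PH|H [[W E] /= PE [_ ->]]//].
by exists (vset H, eset H).
Qed.

Lemma measurable_len (e : {set V}) :
  measurable_fun [set: measurable_wgraph]
    (fun H : measurable_wgraph => if e \in eset H then len H e else 0).
Proof.
move=> _ B mB; rewrite setTI.
rewrite [X in measurable X](_ : _ =
    [set H : wgraph V R | e \in eset H /\ B (len H e)] `|`
    [set H : wgraph V R | (e \notin eset H) && `[< B 0 >] ]).
  apply: measurableU; first by apply: gen; right; exists e, B.
  exact: (measurable_eset (fun E => (e \notin E) && `[< B 0 >])).
apply/seteqP; split => H /=.
  by case: ifP => eH BH; [left|right; rewrite /=; apply/asboolP].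
by case: ifP => eH [[]//|/andP[]// _ /asboolP].
Qed.

Lemma measurable_dist (x y : V) :
  measurable_fun [set: measurable_wgraph]
    (fun H : measurable_wgraph => dist H x y).
Proof.
pose l (H : measurable_wgraph) p : R :=
  \sum_(e <- pairmap (fun a b => [set a; b]%SET) x p)
    (if e \in eset H then len H e else 0).
have lE (H : measurable_wgraph) p :
    path (fun a b => [set a; b]%SET \in eset H) x p -> walk_len H x p = l H p.
  rewrite /walk_len /l; elim: p x {l} => [|b p IH] a /=; first by rewrite !big_nil.
  by move=> /andP[ab /IH]; rewrite !big_cons ab => ->.
have ml p : measurable_fun [set: measurable_wgraph] (l ^~ p).
  by apply: measurable_sum => e; exact: measurable_len.
apply: (measurability _ (ErealGenInftyO.measurableE R)) => _ /= -[_ [r ->] <-].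
rewrite setTI [X in measurable X](_ : _ = \bigcup_p
    ([set H : measurable_wgraph | walk H x y p] `&` l ^~ p @^-1` `]-oo, r[)).
  apply: countable_bigcupT_measurable => // p; apply: measurableI.
    exact: (measurable_eset (fun E =>
      path (fun a b => [set a; b]%SET \in E) x p && (last x p == y))).
  by rewrite -[X in measurable X]setTI; exact: ml.
apply/seteqP; split => H /=; rewrite in_itv/=.
  move=> /ereal_inf_ltP[_ [p /= pH <-]]; rewrite lte_fin => ltr.
  exists p => //; split => //=; rewrite in_itv/= -lE//.
  by case/andP: pH.
move=> [p _ [/= pH]]; rewrite in_itv/= -lE; last by case/andP: pH.
by move=> ltr; apply/ereal_inf_ltP; exists (walk_len H x p)%:E => //; exists p.
Qed.

End RandomGraphs.

(* Main.v *)
Require Import Defs.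
From mathcomp Require Import all_boot all_order all_algebra.
From mathcomp Require Import all_classical all_reals all_analysis.
From mathcomp Require Import measurable_realfun.
Set Implicit Arguments.
Unset Strict Implicit.
Unset Printing Implicit Defensive.
Import Order.TTheory GRing.Theory Num.Theory.
Local Open Scope classical_set_scope.
Local Open Scope ring_scope.
Local Open Scope ereal_scope.

(** A minor of a star is again a star, up to missing edges, because having an
    endpoint common to all edges survives deletions and contractions. If its
    vertex set is [T], the center [u] is a terminal, so the distances between
    the other terminals go through [u] and are at least [2 + 2]. Summed over
    the ordered pairs of distinct terminals, the distances are therefore at
    least [4 (k - 1)^2] for almost every minor, hence so are the expectations,
    and one of these [k (k - 1)] expectations is at least the average
    [4 (1 - 1/k)]. *)

(** [c] may lie outside [vset G]: deleting the center leaves no edge, and the property then holds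
    vacuously. *)
Definition edge_center (V : finType) (G : sgraph V) (c : V) : Prop :=
  forall e, e \in eset G -> c \in e.

Lemma minor_edge_center (V : finType) (T : {set V}) (G H : sgraph V) (c : V) :
  minor T G H -> edge_center G c -> exists c', edge_center H c'.
Proof.
move=> GH Gc; elim: GH => [|K L _ [c' Kc'] KL]; first by exists c.
case: KL => [u _ _|e _|u w _ _].
- by exists c' => e; rewrite inE => /andP[/Kc'].
- by exists c' => f; rewrite inE => /andP[_ /Kc'].
(* Contraction replaces each edge by its image under [redirect u w], so the image of the common
   endpoint is again common. *)
- exists (redirect u w c') => e; rewrite inE => /andP[/imsetP[f /Kc' fc' ->] _].
  exact: imset_f.
Qed.

(** An existing edge forces [c] into [vset G]; without edges any vertex serves. For a minor on [T]
    this makes the center a terminal. *)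
Lemma edge_center_in (V : finType) (G : sgraph V) (c : V) :
  edge_center G c -> (0 < #|vset G|)%N ->
  exists2 u, u \in vset G & edge_center G u.
Proof.
move=> Gc /card_gt0P[w wG]; have [G0|[e eG]] := set_0Vmem (eset G).
  by exists w => // e; rewrite G0 inE.
exists c => //; have /andP[_ /fintype.subsetP] := esetP eG.
by apply; exact: Gc.
Qed.

Lemma walk_len_ge0 (V : finType) (R : realType) (G : wgraph V R) (x y : V)
    (p : seq V) :
  walk G x y p -> (0 <= walk_len G x p)%R.
Proof.
case/andP=> + _; rewrite /walk_len; elim: p x => [|z p IH] x /=.
  by rewrite big_nil.
by move=> /andP[xz /IH ge0]; rewrite big_cons addr_ge0// ltW// len_gt0.
Qed.

Lemma dist_ge0 (V : finType) (R : realType) (G : wgraph V R) (x y : V) :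
  0 <= dist G x y.
Proof. by apply/ereal_infP => _ [p /walk_len_ge0 ? <-]; rewrite lee_fin. Qed.

Lemma dist_le_walk_len (V : finType) (R : realType) (G : wgraph V R) (x y : V)
    (p : seq V) :
  walk G x y p -> dist G x y <= (walk_len G x p)%:E.
Proof. by move=> xyp; apply: ereal_inf_lbound; exists p. Qed.

(** The first edge of a walk from [x] contains [u], and [x != u], so its other end is [u]; cutting
    the walk there bounds its length. *)
Lemma dist_via_center (V : finType) (R : realType) (G : wgraph V R)
    (u x y : V) :
  edge_center G u -> x != u -> x != y ->
  dist G x u + dist G u y <= dist G x y.
Proof.
move=> Gu xu xy; apply/ereal_infP => _ [[|z p] /= xyp <-].
  by move: xyp; rewrite /walk /= (negPf xy).
have /andP[/= /andP[xz zp] zpy] := xyp.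
have /set2P[uE|uE] := Gu _ xz; first by rewrite uE eqxx in xu.
rewrite -uE in xz zp zpy *.
have -> : walk_len G x (u :: p) = (walk_len G x [:: u] + walk_len G u p)%R.
  by rewrite /walk_len /= big_cons big_seq1.
rewrite EFinD leeD// dist_le_walk_len//; last by rewrite /walk zp.
by rewrite /walk /= xz eqxx.
Qed.

Lemma unweighted_walk_len (V : finType) (R : realType) (G : wgraph V R)
    (x y : V) (p : seq V) :
  unweighted G -> walk G x y p -> walk_len G x p = (size p)%:R.
Proof.
move=> G1 /andP[+ _]; rewrite /walk_len; elim: p x => [|z p IH] x /=.
  by rewrite big_nil.
by move=> /andP[xz /IH E]; rewrite big_cons E G1// -natr1 addrC.
Qed.

Lemma star_edge_center (V : finType) (T : {set V}) (v : V) (G : sgraph V) :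
  is_star T v G -> edge_center G v.
Proof. by case=> _ _ EG e; rewrite EG => /imsetP[t _ ->]; rewrite !inE eqxx. Qed.

Lemma star_dist (V : finType) (R : realType) (T : {set V}) (v : V)
    (G : wgraph V R) (x y : V) :
  is_star T v G -> unweighted G -> x \in T -> y \in T -> x != y ->
  dist G x y = 2%:E.
Proof.
move=> sG G1 xT yT xy; have Gv := star_edge_center sG; case: sG => vT _ EG.
have xvy : walk G x y [:: v; y].
  rewrite /walk /= eqxx !andbT EG; apply/andP; split; apply/imsetP.
    by exists x => //; rewrite finset.setUC.
  by exists y.
apply/eqP; rewrite eq_le; apply/andP; split.
  by have := dist_le_walk_len xvy; rewrite (unweighted_walk_len G1 xvy).
apply/ereal_infP => _ [p xyp <-]; rewrite (unweighted_walk_len G1 xyp).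
rewrite lee_fin ler_nat; case: p xyp => [|a [|b p]]//.
  by rewrite /walk /= (negPf xy).
(* A one-edge walk would make [v] equal to [x] or [y], hence a terminal. *)
rewrite /walk /= andbT => /andP[/Gv /set2P va /eqP ay].
by move: vT; case: va => ->; rewrite ?ay ?xT ?yT.
Qed.

Definition offdiag (V : finType) (T : {set V}) : {set V * V} :=
  [set p : V * V | [&& p.1 \in T, p.2 \in T & p.1 != p.2]]%SET.

Lemma sum_offdiag1 (V : finType) (T : {set V}) (F : V -> nat) :
  (\sum_(p in offdiag T) F p.1 = (\sum_(t in T) F t) * #|T|.-1)%N.
Proof.
transitivity (\sum_(t in T) \sum_(t' in T :\ t) F t)%N.
  rewrite pair_big_dep; apply: eq_bigl => -[t t']; rewrite !inE /=.
  by rewrite [t' == t]eq_sym [X in _ && X]andbC.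
rewrite big_distrl /=; apply: eq_bigr => t tT.
by rewrite sum_nat_const (cardsD1 t T) tT /= mulnC.
Qed.

Lemma sum_offdiag2 (V : finType) (T : {set V}) (F : V -> nat) :
  (\sum_(p in offdiag T) F p.2 = \sum_(p in offdiag T) F p.1)%N.
Proof.
have swapK : involutive (fun p : V * V => (p.2, p.1)) by case.
rewrite (reindex_inj (inv_inj swapK)); apply: eq_bigl => -[t t'].
by rewrite !inE /= eq_sym andbCA.
Qed.

Lemma card_offdiag (V : finType) (T : {set V}) :
  #|offdiag T| = (#|T| * #|T|.-1)%N.
Proof. by rewrite -sum1_card (sum_offdiag1 T (fun=> 1%N)) sum1_card. Qed.

(** In either coordinate, each of the [#|T|.-1] terminals other than [u] occurs in [#|T|.-1]
    pairs. *)
Lemma sum_offdiag_neq (V : finType) (T : {set V}) (u : V) : u \in T ->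
  (\sum_(p in offdiag T) ((p.1 != u) + (p.2 != u)) = 2 * #|T|.-1 ^ 2)%N.
Proof.
move=> uT; rewrite big_split /= (sum_offdiag2 T (fun t => t != u)).
rewrite (sum_offdiag1 T (fun t => t != u)) addnn -mul2n expnS expn1.
congr (_ * (_ * _))%N.
rewrite (big_setD1 u)//= eqxx add0n (cardsD1 u T) uT /= -sum1_card.
by apply: eq_bigr => t; rewrite !inE => /andP[->].
Qed.

Lemma star_minor_sum_dist (V : finType) (R : realType) (T : {set V}) (v : V)
    (G H : wgraph V R) :
  is_star T v G -> unweighted G -> (0 < #|T|)%N -> minor T G H -> vset H = T ->
  (forall t t', t \in T -> t' \in T -> dist G t t' <= dist H t t') ->
  (4 * #|T|.-1 ^ 2)%:R%:E <= \sum_(p in offdiag T) dist H p.1 p.2.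
Proof.
move=> sG G1 T0 GH HT dGH.
have [c Hc] := minor_edge_center GH (star_edge_center sG).
have [|u] := edge_center_in Hc; rewrite HT// => uT Hu.
have ge2 x y : x \in T -> y \in T -> x != y -> 2%:E <= dist H x y.
  by move=> xT yT xy; rewrite -(star_dist sG G1 xT yT xy) dGH.
rewrite (_ : 4 * _ = 2 * (2 * #|T|.-1 ^ 2))%N; last by rewrite mulnA.
rewrite -(sum_offdiag_neq uT) big_distrr /= natr_sum -sumEFin.
apply: lee_sum => -[x y]; rewrite inE /= => /and3P[xT yT xy].
(* The distance is at least 2 for each endpoint other than [u]; if both differ from [u], the walk
   splits at [u] into two parts of length at least 2. *)
have [xu|xu] := eqVneq x u; have [yu|yu] := eqVneq y u => //=.
- by rewrite muln0 dist_ge0.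
- exact: ge2.
- exact: ge2.
apply: le_trans (dist_via_center Hu xu xy).
by rewrite (natrD _ 2 2) EFinD leeD// ge2// eq_sym.
Qed.

Lemma exists_ge_average (R : realType) (I : eqType) (s : seq I)
    (f : I -> \bar R) (c : R) :
  (0 < size s)%N -> ((size s)%:R * c)%:E <= \sum_(i <- s) f i ->
  exists2 i, i \in s & c%:E <= f i.
Proof.
elim: s => // a s IH _; rewrite big_cons /= => le_sum.
have [?|lt_a] := leP c%:E (f a); first by exists a; rewrite ?mem_head.
have [||i si ci] := IH; last by exists i; rewrite // inE si orbT.
  (* The induction hypothesis needs a nonempty tail; for an empty one, [le_sum] already contradicts
     [lt_a]. *)
  by case: s le_sum {IH} => //=; rewrite big_nil adde0 mul1r leNgt lt_a.
rewrite leNgt; apply/negP => lt_s; move: le_sum; apply/negP; rewrite -ltNge.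
by rewrite -natr1 mulrDl mul1r addrC EFinD lteD.
Qed.

(** Total mass 1 turns [c] into the integral of a constant, and the integral is monotone up to null
    sets. *)
Lemma probability_ae_le_integral d (T : measurableType d) (R : realType)
    (P : probability T R) (f : T -> \bar R) (c : R) :
  (0 <= c)%R -> measurable_fun setT f -> (forall x, 0 <= f x) ->
  {ae P, forall x, c%:E <= f x} -> c%:E <= \int[P]_x f x.
Proof.
move=> c0 mf f0 cf.
rewrite -[leLHS]mule1 -(probability_setT P) -integral_cst//.
by apply: ae_ge0_le_integral => //; apply: filterS cf.
Qed.

Theorem lemma3p14 (R : realType) (V : finType) (T : {set V}) (v : V)
    (G : wgraph V R) (k : nat) (pi : probability (measurable_wgraph V R) R) :
  is_star T v G -> unweighted G -> #|T| = k -> (3 <= k)%N ->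
  {ae pi, forall H : measurable_wgraph V R, minor T G H /\ vset H = T} ->
  {ae pi, forall H : measurable_wgraph V R,
     forall t t', t \in T -> t' \in T -> dist G t t' <= dist H t t'} ->
  exists t' t'', [/\ t' \in T, t'' \in T, t' != t'' &
    (2 * (1 - k%:R^-1))%:E <= (\int[pi]_H dist H t' t'') / dist G t' t''].
Proof.
move=> sG G1 kT k3 minH domH.
have T0 : (0 < #|T|)%N by rewrite kT (leq_trans _ k3).
have sz : size (enum (offdiag T)) = (k * k.-1)%N.
  by rewrite -cardE card_offdiag kT.
(* The threshold is the target ratio times 2, the distance of two terminals in the star. *)
have [||[x y]] := @exists_ge_average R _ (enum (offdiag T))
    (fun p => \int[pi]_H dist H p.1 p.2) (4 * (1 - k%:R^-1)).
- by rewrite sz; case: k k3 {kT sz} => [|[]].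
(* The sum of the expectations is the expectation of the sum, which is bounded for almost every
   minor. *)
- rewrite -ge0_integral_sum//; last 2 first.
    by move=> p; exact: measurable_dist.
    by move=> p H _; exact: dist_ge0.
  have -> : ((size (enum (offdiag T)))%:R * (4 * (1 - k%:R^-1)) =
             (4 * #|T|.-1 ^ 2)%:R :> R)%R.
    rewrite sz kT; case: k k3 {kT sz} => // k _ /=.
    rewrite !natrM mulrCA; congr (_ * _)%R.
    by rewrite mulrBr mulr1 mulrAC mulfV ?pnatr_eq0// mul1r -natr1 mulrDl mul1r addrK.
  apply: probability_ae_le_integral => //.
  + by apply: emeasurable_sum => p; exact: measurable_dist.
  + by move=> H; apply: sume_ge0 => p _; exact: dist_ge0.
  + move: minH domH; apply: filterS2 => H [GH HT] dGH.
    by rewrite big_enum; exact: (star_minor_sum_dist sG).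
rewrite mem_enum inE /= => /and3P[xT yT xy] le_int.
(* The quotient is taken in the extended reals: [inver] tests the denominator for 0, and here it is
   2. *)
exists x, y; split => //; rewrite (star_dist sG G1 xT yT xy) inver.
rewrite pnatr_eq0 /= lee_pdivlMr// -EFinM; apply: le_trans le_int.
by rewrite lee_fin mulrAC -natrM.
Qed.
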